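(* Let $p \geq 3$ be a prime and let $G$ be a finite group with characteristic $p$. Let $S$ be a $p$-subgroup of $G$ with $O_p(G) \leq S$. Then at least one of the following holds: (a) $K^{\infty}(S) \trianglelefteq G$; or (b) there exist $g \in S \setminus O_p(G)$ and a $G$-chief factor $V$ of $O_p(G)$ on which $g$ acts nontrivially and quadratically, i.e. $[V,g] \neq 1$ and $[V,g,g] = 1$.
   Context: All groups are finite. A group $G$ has characteristic $p$ if $C_G(O_p(G)) \leq O_p(G)$. A $G$-chief factor of a normal subgroup $P$ of $G$ is a quotient $X/Y$ where $Y < X \leq P$ are normal subgroups of $G$ and no normal subgroup of $G$ lies strictly between $Y$ and $X$; $G$ acts on it by conjugation. An element $g$ acts quadratically on $V$ if $[V,g,g] = 1$. Commutators are left-normed: $[A,B,B] = [[A,B],B]$. For a group $S$, let $\mathrm{sgp}(S)$ denote the set of all subgroups of $S$. For $\Sigma \subseteq \mathrm{sgp}(S)$, write $B \leq\in \Sigma$ to mean that $B$ is a subgroup of some member of $\Sigma$. Definition of $\mathcal{K}(-,-)$: for a $p$-group $S$ and $\Sigma \subseteq \mathrm{sgp}(S)$, $\mathcal{K}(S,\Sigma)$ is the set of all $A \in \mathrm{sgp}(S)$ such that (i) $A$ has nilpotency class at most two (i.e. $[A,A] \leq Z(A)$); (ii) $A$ is normalized by each member of $\Sigma$; (iii) whenever $B \leq\in \Sigma$ satisfies $[A,B,B] \leq Z(A)$, then $[A,B] \leq Z(A)$. Define $\mathcal{K}_0(S) = \mathrm{sgp}(S)$ and $\mathcal{K}_{i+1}(S)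 = \mathcal{K}(S,\mathcal{K}_i(S))$ for all $i \geq 0$; $\mathcal{K}^{\infty}(S) = \bigcap_{i \text{ even}} \mathcal{K}_i(S)$; and $K^{\infty}(S) = \langle\, \mathcal{K}^{\infty}(S)\,\rangle$, the subgroup of $S$ generated by all members of $\mathcal{K}^{\infty}(S)$. *)

(* Defs.v *)
From mathcomp Require Import all_boot all_fingroup all_solvable.
From mathcomp Require Import boolp.

Set Implicit Arguments.
Unset Strict Implicit.
Unset Printing Implicit Defensive.

Local Open Scope group_scope.

Section KInfty.

Variable gT : finGroupType.
Implicit Types (S A B : {group gT}) (Sigma : {set {group gT}}).

Definition sub_member B Sigma := [exists C in Sigma, B \subset C].

Definition Kop S Sigma : {set {group gT}} :=
  [set A in subgroups S |
    [&& [~: A, A] \subset 'Z(A),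
        [forall B in Sigma, B \subset 'N(A)] &
        [forall B : {group gT},
          sub_member B Sigma ==>
          ([~: A, B, B] \subset 'Z(A)) ==> ([~: A, B] \subset 'Z(A))]]].

Fixpoint Kseq S (i : nat) : {set {group gT}} :=
  if i is j.+1 then Kop S (Kseq S j) else subgroups S.

(* The intersection ranges over infinitely many i, so membership is a Prop;
   it is turned into a finite set by classical reflection. *)
Definition Kinfty_members S : {set {group gT}} :=
  [set A : {group gT} | `[< forall i, ~~ odd i -> A \in Kseq S i >]].

Definition Kinfty S : {set gT} := << \bigcup_(A in Kinfty_members S) A >>.

Definition of_characteristic (p : nat) (G : {group gT}) : bool :=
  'C_G('O_p(G)) \subset 'O_p(G).

(* Meaningful when g normalises Y: the action of g on X / Y by conjugation is
   then conjugation by the coset of g inside 'N(Y) / Y. *)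
Definition acts_nontrivially_on (g : gT) (X Y : {group gT}) : bool :=
  [~: X / Y, [set coset Y g]] != 1.

Definition acts_quadratically_on (g : gT) (X Y : {group gT}) : bool :=
  [~: X / Y, [set coset Y g], [set coset Y g]] == 1.

End KInfty.

(* Main.v *)
(* Suppose (b) fails and put P = O_p(G).  Every member B of K_2(S) lies in P.
   Otherwise let N be the normal closure of B in G and N0 the subgroup
   generated by the p'-elements of N; N0 does not centralise P, so choose Y in P
   minimal among the normal subgroups of G not centralised by N0, and X maximal
   among the normal subgroups of G properly inside Y.  Then Y = [Y, N0] and N0
   centralises X, so X <= Z(Y) by the three subgroups lemma, and Y/X is chief.
   By the failure of (b), Y is in K_1(S), so Y normalises B.  The subgroup R of
   the y in Y with [y, Y] <= C(B) contains [Y, B, B], and [R, B, B] = 1 by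
   condition (iii) for B.  Since N0 B is subnormal in G, Y/X is semisimple under
   N0 B, so B acts quadratically, hence trivially, on Y/X.  Thus
   Y = [Y, N] <= X, a contradiction.
   Since K_i(S) is contained in K_2(S) for all i >= 1, all these groups lie in P,
   so that K_(2i+2)(S) <= K_2i(P) <= K_2i(S): the group K^oo(S) is K^oo(P), which
   is invariant under G. *)
Require Import Defs.
From mathcomp Require Import all_boot all_fingroup all_solvable.

Set Implicit Arguments.
Unset Strict Implicit.
Unset Printing Implicit Defensive.

Local Open Scope group_scope.

(** * Monotonicity and conjugation invariance of the operator and its iterates *)

Section KopTheory.

Variable gT : finGroupType.
Implicit Types (S Q A B C : {group gT}) (Sigma : {set {group gT}}).

Lemma KopP S Sigma A :
  reflect [/\ A \subset S, [~: A, A] \subset 'Z(A),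
              forall B, B \in Sigma -> B \subset 'N(A) &
              forall B, sub_member B Sigma -> [~: A, B, B] \subset 'Z(A) ->
                [~: A, B] \subset 'Z(A)]
          (A \in Kop S Sigma).
Proof.
rewrite !inE; apply: (iffP and4P) => [[sAS cl2 /forall_inP nA /forallP cA]|].
  split=> // B sB qB; have /implyP := cA B.
  by move/(_ sB)/implyP/(_ qB).
case=> sAS cl2 nA cA; split=> //; first exact/forall_inP.
by apply/forallP=> B; apply/implyP=> sB; apply/implyP; apply: cA.
Qed.

Lemma sub_memberS B Sigma1 Sigma2 :
  Sigma1 \subset Sigma2 -> sub_member B Sigma1 -> sub_member B Sigma2.
Proof.
move=> /subsetP s12 /exists_inP[C C1 sBC].
by apply/exists_inP; exists C; rewrite ?s12.
Qed.

(** Conditions (ii) and (iii) quantify over [Sigma], so shrinking it weakens them; [S] enters only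
    through [A \subset S]. *)
Lemma KopS S1 S2 Sigma1 Sigma2 A :
    A \subset S2 -> Sigma2 \subset Sigma1 ->
  A \in Kop S1 Sigma1 -> A \in Kop S2 Sigma2.
Proof.
move=> sAS2 s21 /KopP[_ cl2 nA cA]; apply/KopP; split=> // B sB.
  exact/nA/(subsetP s21).
exact/cA/(sub_memberS s21).
Qed.

Lemma Kseq_subgroups S i A : A \in Kseq S i -> A \subset S.
Proof. by case: i => [|i]; [rewrite inE | case/KopP]. Qed.

(** At index 1 the conditions are tested against all subgroups of [S], the largest possible
    [Sigma]. *)
Lemma Kseq1_min S i : Kseq S 1 \subset Kseq S i.
Proof.
apply/subsetP=> A KA; have sAS := Kseq_subgroups KA.
case: i => [|i]; first by rewrite inE.
apply: KopS KA => //; apply/subsetP=> B /Kseq_subgroups.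
by rewrite inE.
Qed.

Lemma Kseq2_max S i : Kseq S i.+1 \subset Kseq S 2.
Proof.
apply/subsetP=> A KA.
exact: KopS (Kseq_subgroups KA) (Kseq1_min S i) KA.
Qed.

Lemma KseqJ S i A g :
  g \in 'N(S) -> A \in Kseq S i -> (A :^ g)%G \in Kseq S i.
Proof.
elim: i => [|i IHi] in A g * => nSg.
  by rewrite !inE /= => sAS; rewrite -(normP nSg) conjSg.
case/KopP=> sAS cl2 nA cA; have nSg' := groupVr nSg.
have ZJ : 'Z(A :^ g) = 'Z(A) :^ g by rewrite /center conjIg centJ.
apply/KopP; split=> [|||B /exists_inP[C KC sBC]] /=.
- by rewrite -(normP nSg) conjSg.
- by rewrite -conjsRg ZJ conjSg.
- move=> B /(IHi _ _ nSg')/nA; rewrite normJ /=.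
  by rewrite sub_conjgV.
have sB : sub_member (B :^ g^-1)%G (Kseq S i).
  by apply/exists_inP; exists (C :^ g^-1)%G; rewrite ?IHi //= conjSg.
have := cA _ sB; rewrite /= ZJ.
have -> : [~: A :^ g, B] = [~: A, B :^ g^-1] :^ g by rewrite conjsRg conjsgKV.
have -> : [~: [~: A, B :^ g^-1] :^ g, B] = [~: A, B :^ g^-1, B :^ g^-1] :^ g.
  by rewrite [in RHS]conjsRg conjsgKV.
by rewrite !conjSg.
Qed.

Lemma Kinfty_membersP S A :
  reflect (forall i, ~~ odd i -> A \in Kseq S i) (A \in Kinfty_members S).
Proof. by rewrite inE; apply: boolp.asboolP. Qed.

Lemma norm_Kinfty S : 'N(S) \subset 'N(Kinfty S).
Proof.
apply/subsetP=> g nSg; apply: (subsetP (norm_gen _)); rewrite inE.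
apply/subsetP=> _ /imsetP[x /bigcupP[A KA Ax] ->].
apply/bigcupP; exists (A :^ g)%G; last by rewrite /= memJ_conjg.
by apply/Kinfty_membersP=> i oi; apply: KseqJ => //; apply/Kinfty_membersP: i oi.
Qed.

(* The two sequences interleave: with indices of the same parity they are
   comparable, and shifting the one of [S] by two reverses the comparison. *)
Lemma Kinfty_restrict S Q :
    Q \subset S -> (forall A, A \in Kseq S 2 -> A \subset Q) ->
  Kinfty S = Kinfty Q.
Proof.
move=> sQS K2Q.
have KQ i A : A \in Kseq S i.+1 -> A \subset Q.
  by move=> KA; apply/K2Q/(subsetP (Kseq2_max S i)).
have le i : if odd i then Kseq S i \subset Kseq Q i
            else Kseq Q i \subset Kseq S i.
  elim: i => [|i IHi] /=.
    by apply/subsetP=> A; rewrite !inE => /subset_trans; apply.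
  case: (odd i) IHi => /= sK; apply/subsetP=> A KA.
    exact: KopS (subset_trans (@Kseq_subgroups Q i.+1 A KA) sQS) sK KA.
  exact: KopS (KQ i A KA) sK KA.
have ge i : if odd i then Kseq Q i \subset Kseq S i.+2
            else Kseq S i.+2 \subset Kseq Q i.
  elim: i => [|i IHi].
    by apply/subsetP=> A /KQ; rewrite inE.
  rewrite [odd _]/=; case: (odd i) IHi => /= sK; apply/subsetP=> A KA.
    exact: KopS (KQ i.+2 A KA) sK KA.
  exact: KopS (subset_trans (@Kseq_subgroups Q i.+1 A KA) sQS) sK KA.
rewrite /Kinfty; suff -> : Kinfty_members S = Kinfty_members Q by [].
apply/setP=> A; apply/Kinfty_membersP/Kinfty_membersP=> KA i oi.
  have := ge i; rewrite (negPf oi) => /subsetP; apply.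
  by apply: KA; rewrite /= negbK.
by have := le i; rewrite (negPf oi) => /subsetP; apply; apply: KA.
Qed.

End KopTheory.

(** * Clifford theory along subnormal chains *)

Section Socle.

Variable gT : finGroupType.
Implicit Types (G H K U V : {group gT}).

(** Since [minnormal U H] asks only that [H] normalise [U], this is the socle of [V] under the
    action of [H]; its equality with [V] expresses semisimplicity. *)
Definition minnormal_socle H V :=
  << \bigcup_(U : {group gT} | minnormal U H && (U \subset V)) U >>.

Lemma minnormal_socle_sub H V : minnormal_socle H V \subset V.
Proof. by rewrite gen_subG; apply/bigcupsP=> U /andP[]. Qed.

(** Clifford's argument: [G] normalises [H], hence permutes the minimal [H]-invariant subgroups of
    [V]; the nontrivial group they generate is [G]-invariant, and [V] is minimal. *)
Lemma minnormal_socle_normal G H V :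
  H <| G -> minnormal V G -> minnormal_socle H V = V.
Proof.
move=> /andP[sHG nHG] minV; have [/andP[ntV nVG] minVP] := mingroupP minV.
apply: (minVP [group of minnormal_socle H V]); last exact: minnormal_socle_sub.
have [U minU sUV] := minnormal_exists ntV (subset_trans sHG nVG).
have /andP[ntU _] := mingroupp minU.
apply/andP; split.
  apply: contraNneq ntU => S1; rewrite -subG1 -S1 sub_gen //.
  by apply: (bigcup_max U); rewrite ?minU.
apply/subsetP=> g Gg; apply: (subsetP (norm_gen _)); rewrite inE.
apply/subsetP=> _ /imsetP[x /bigcupP[W /andP[minW sWV] Wx] ->].
apply/bigcupP; exists (W :^ g)%G; last by rewrite /= memJ_conjg.
rewrite /= -(normsP nVG g Gg) conjSg sWV andbT.
have [/andP[ntW nWH] minWP] := mingroupP minW.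
apply/mingroupP; rewrite /= conjsg_eq1 ntW normJ -{1}(normsP nHG g Gg) conjSg.
split=> // L /andP[ntL nLH] sLW.
have eqL : (L :^ g^-1)%G :=: W.
  apply: minWP; last by rewrite /= sub_conjgV.
  rewrite /= conjsg_eq1 ntL normJ -{1}(normsP nHG g^-1) ?groupV //.
  by rewrite conjSg.
by rewrite -eqL /= conjsgKV.
Qed.

(** Induction down a subnormal chain: [V] is generated by minimal [K]-invariant subgroups, and
    Clifford's argument for [H] normal in [K] applies to each of them. *)
Lemma minnormal_socle_subnormal G H V :
  H <|<| G -> minnormal V G -> minnormal_socle H V = V.
Proof.
move=> snHG minV; have [n] := ubnP (#|G| - #|H|); elim: n => // n IHn in H snHG *.
rewrite ltnS => leHn.
have [eqHG | [K [nHK snKG pHK]]] := subnormalEl snHG.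
  by apply: (minnormal_socle_normal _ minV); rewrite eqHG normal_refl.
have socK : minnormal_socle K V = V.
  apply: IHn => //; apply: leq_trans leHn; apply: ltn_sub2l.
    exact: leq_trans (proper_card pHK) (subset_leq_card (subnormal_sub snKG)).
  exact: proper_card.
apply/eqP; rewrite eqEsubset minnormal_socle_sub -{1}socK gen_subG.
apply/bigcupsP=> U /andP[minU sUV].
rewrite -(minnormal_socle_normal nHK minU) genS //.
apply/bigcupsP=> W /andP[minW sWU]; apply: (bigcup_max W) => //.
by rewrite minW (subset_trans sWU).
Qed.

(** Normalisers grow in the nilpotent group [G / K], so repeatedly passing from [H] to its
    normaliser reaches [G]. *)
Lemma subnormal_pquotient (p : nat) G H K :
    K <| G -> p.-group (G / K) -> K \subset H -> H \subset G -> H <|<| G.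
Proof.
move=> nKG pGK; have [n] := ubnP (#|G| - #|H|).
elim: n => // n IHn in H * => leHn sKH sHG.
have [-> | pHG] := eqVproper sHG; first exact: subnormal_refl.
have nKH : K <| H := normalS sKH sHG nKG.
pose M := 'N_G(H)%G.
have nHM : H <| M by rewrite /normal subsetI sHG normG subsetIr.
have pHM : H \proper M.
  rewrite properEneq normal_sub // andbT; apply/eqP=> eqHM.
  have pHK : H / K \proper G / K by rewrite quotient_proper.
  have := nilpotent_proper_norm (pgroup_nil pGK) pHK.
  by rewrite -quotient_subnormG // -[in X in _ \proper X]eqHM properxx.
apply: subnormal_trans (normal_subnormal nHM) _; apply: IHn.
- rewrite ltnS in leHn; apply: leq_trans leHn; apply: ltn_sub2l.
    exact: proper_card.
  exact: proper_card.
- exact: subset_trans sKH (normal_sub nHM).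
exact: subsetIl.
Qed.

End Socle.

(** * The subgroup generated by the p'-elements *)

Section PprimeGen.

Variables (gT : finGroupType) (p : nat).
Implicit Types (G N Y : {group gT}).

(** For [p] prime this is O^p(N), the smallest normal subgroup with a p-group as quotient. *)
Definition pprime_gen N := << [set x in N | p^'.-elt x] >>%G.

Lemma pprime_gen_sub N : pprime_gen N \subset N.
Proof. by rewrite gen_subG; apply/subsetP=> x; rewrite inE => /andP[]. Qed.

Lemma pprime_gen_norm G N : G \subset 'N(N) -> G \subset 'N(pprime_gen N).
Proof.
move=> nNG; apply/norms_gen/subsetP=> g Gg; rewrite inE.
apply/subsetP=> _ /imsetP[x + ->]; rewrite !inE p_eltJ.
by rewrite memJ_norm ?(subsetP nNG).
Qed.

(** The p'-part of any [x] in [N] vanishes in the quotient, so each coset is that of a p-element;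
    Cauchy's theorem then excludes every prime other than [p]. *)
Lemma pprime_gen_quotient N : prime p -> p.-group (N / pprime_gen N).
Proof.
move=> p_pr; apply/pgroupP=> q q_pr /(Cauchy q_pr)[xb /morphimP[x Nx Nx' ->] ox].
suff: p.-elt (coset (pprime_gen N) x).
  by rewrite /p_elt ox pnatE.
rewrite -(consttC p x) morphM /=; last first.
- by rewrite groupX.
- by rewrite groupX.
rewrite [X in _ * X]coset_id; last first.
  by apply: mem_gen; rewrite inE groupX // p_elt_constt.
by rewrite mulg1 morph_p_elt ?groupX // p_elt_constt.
Qed.

Lemma pprime_gen_pgroup N : p.-group (pprime_gen N) -> prime p -> p.-group N.
Proof.
move=> pN0 p_pr; have := pprime_gen_quotient N p_pr.
have nsN : pprime_gen N <| N.
  by rewrite /normal pprime_gen_sub pprime_gen_norm ?normG.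
by rewrite -(pquotient_pgroup pN0) // normal_norm.
Qed.

(** Coprime action: a p'-element [x] centralises both [D = [Y, x]] and [Y / D]. Fixed points on
    [Y / D] lift to [Y], so Y = C_Y(x) D is centralised by [x]. *)
Lemma pprime_gen_cent N Y :
    p.-group Y -> N \subset 'N(Y) ->
  [~: Y, pprime_gen N, pprime_gen N] = 1 -> [~: Y, pprime_gen N] = 1.
Proof.
move=> pY nYN qY; apply/commG1P; rewrite centsC gen_subG.
apply/subsetP=> x; rewrite inE => /andP[Nx p'x].
have N0x : <[x]> \subset pprime_gen N.
  by rewrite cycle_subG mem_gen // inE Nx.
have nYx : <[x]> \subset 'N(Y) by rewrite cycle_subG (subsetP nYN).
rewrite -cycle_subG centsC; set D := [~: Y, <[x]>]%G.
have sDY : D \subset Y by rewrite commg_subl.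
have cDx : D \subset 'C(<[x]>).
  by apply/commG1P/trivgP; rewrite -qY !commgSS.
have nDY : Y \subset 'N(D) := commg_norml _ _.
have nDx : <[x]> \subset 'N(D) := commg_normr _ _.
have eqQ : 'C_Y(<[x]>) / D = Y / D.
  rewrite coprime_quotient_cent ?(pgroup_sol pY) ?(pnat_coprime pY) //.
  by apply/setIidPl; rewrite quotient_cents2.
apply: subset_trans (mul_subG cDx (subsetIr Y _)).
by rewrite -quotientSK // eqQ.
Qed.

End PprimeGen.

(** * Chief factors inside a normal p-subgroup *)

Section ChiefFactors.

Variable gT : finGroupType.
Implicit Types (G B C N X Y P : {group gT}).

(** The nontrivial normal subgroup [Y / X] of the p-group [P / X] meets its centre nontrivially;
    this intersection is [G]-invariant, hence all of [Y / X]. *)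
Lemma chief_factor_cent (p : nat) G P X Y :
    p.-group P -> P <| G -> Y \subset P -> chief_factor G X Y ->
  [~: Y, P] \subset X.
Proof.
move=> pP nsPG sYP chf; have minV := chief_factor_minnormal chf.
have /andP[/maxgroupp/andP[pXY nXG] nsYG] := chf.
have [/andP[ntV nVG] minVP] := mingroupP minV.
have nXP := subset_trans (normal_sub nsPG) nXG.
have nXY := subset_trans sYP nXP.
have nsVP : Y / X <| P / X.
  by apply/quotient_normal/(normalS sYP (normal_sub nsPG) nsYG).
have ntI := meet_center_nil (quotient_nil X (pgroup_nil pP)) nsVP ntV.
have eqV : (Y / X :&: 'Z(P / X))%G :=: Y / X.
  apply: minVP (subsetIl _ _); rewrite /= ntI normsI //.
  by rewrite gFnorm_trans // quotient_norms // normal_norm.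
by rewrite -quotient_cents2 // -eqV subIset // orbC subsetIr.
Qed.

End ChiefFactors.

(** * Quadratic action on a semisimple module *)

Section QuadraticOnSocle.

Variable gT : finGroupType.
Implicit Types (G H B R U V : {group gT}).

(* A semisimple action that is quadratic on [R] and on [V / R] is quadratic. *)
Lemma quadratic_subnormal G H B R V :
    H <|<| G -> minnormal V G -> abelian V -> B \subset H ->
    H \subset 'N(R) -> [~: V, B, B] \subset R -> [~: R, B, B] = 1 ->
  [~: V, B, B] = 1.
Proof.
move=> snHG minV abV sBH nRH sVR qR.
have nVB : B \subset 'N(V).
  have /andP[_ nVG] := mingroupp minV.
  exact: subset_trans (subset_trans sBH (subnormal_sub snHG)) nVG.
(* As [V] is abelian, [[~ v, b]] is multiplicative in [v], so [W] is a group; it suffices that it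
   contain each minimal [H]-invariant subgroup of [V]. *)
pose W := [set v in V | [set [~ v, b] | b in B] \subset 'C(B)].
have memV v b : v \in V -> b \in B -> [~ v, b] \in V.
  by move=> Vv Bb; apply: (subsetP _ _ (mem_commg Vv Bb)); rewrite commg_subl.
have gW : group_set W.
  apply/group_setP; split.
    rewrite inE group1; apply/subsetP=> _ /imsetP[b Bb ->].
    by rewrite comm1g group1.
  move=> v w; rewrite !inE => /andP[Vv cv] /andP[Vw cw].
  rewrite groupM //; apply/subsetP=> _ /imsetP[b Bb ->].
  rewrite commMgJ [_ ^ w]conjgE (centsP abV _ (memV v b Vv Bb) w Vw) mulKg.
  apply: groupM; first exact: (subsetP cv) _ (imset_f _ _).
  exact: (subsetP cw) _ (imset_f _ _).
have sVW : V \subset W.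
  rewrite -{1}(minnormal_socle_subnormal snHG minV) (gen_subG _ (Group gW)).
  apply/bigcupsP=> U /andP[minU sUV].
  have [/andP[ntU nUH] minUP] := mingroupP minU.
  have nUB := subset_trans sBH nUH.
  have qU : [~: U, B, B] = 1.
    (* [H] normalises [U :&: R], so by minimality it is trivial, and then contains [U, B, B], or it
       is [U], and quadratic action on [R] applies. *)
    have [I1 | ntI] := eqVneq (U :&: R) 1.
      apply/trivgP; rewrite -I1 subsetI (subset_trans _ sVR) ?commgSS // andbT.
      by apply: subset_trans (commSg _ (_ : _ \subset U)) _; rewrite commg_subl.
    have sUR : U \subset R.
      have <- : (U :&: R)%G :=: U by apply: minUP; rewrite ?subsetIl //= ntI normsI.
      exact: subsetIr.
    by apply/trivgP; rewrite -qR !commgSS.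
  apply/subsetP=> u Uu; rewrite inE (subsetP sUV) //=.
  apply/subsetP=> _ /imsetP[b Bb ->].
  by apply: (subsetP (_ : [~: U, B] \subset _)); [exact/commG1P | exact: mem_commg].
apply/commG1P; rewrite gen_subG; apply/subsetP=> _ /imset2P[v b Vv Bb ->].
by have:= subsetP sVW v Vv; rewrite inE => /andP[_ /subsetP]; apply; apply: imset_f.
Qed.

End QuadraticOnSocle.

(** * Members of K_2(S) lie in O_p(G) *)

Section Main.

Variables (gT : finGroupType) (p : nat) (G S : {group gT}).
Implicit Types (B C N X Y : {group gT}).

Let P := 'O_p(G).

Hypothesis p_pr : prime p.
Hypothesis charG : of_characteristic p G.
Hypothesis sSG : S \subset G.
Hypothesis sPS : P \subset S.
Hypothesis no_quad : forall g X Y,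
  g \in S :\: P -> X \subset P -> chief_factor G Y X ->
  acts_quadratically_on g X Y -> ~~ acts_nontrivially_on g X Y.

Let pP : p.-group P := pcore_pgroup p G.
Let nsPG : P <| G := pcore_normal p G.

Lemma chief_factorP X Y :
  reflect [/\ X \proper Y, Y <| G, G \subset 'N(X) &
            forall Z : {group gT}, X \subset Z -> Z \subset Y ->
              G \subset 'N(Z) -> Z :=: X \/ Z :=: Y]
          (chief_factor G X Y).
Proof.
apply: (iffP andP) => [[/maxgroupP[/andP[pXY nXG] maxX] nsYG] | ].
  split=> // Z sXZ sZY nZG; have [-> | pZY] := eqVproper sZY; first by right.
  by left; apply: maxX; rewrite ?pZY.
case=> pXY nsYG nXG maxX; split=> //; apply/maxgroupP; split; first exact/andP.
move=> Z /andP[pZY nZG] sXZ.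
have [//|eZ] := maxX Z sXZ (proper_sub pZY) nZG.
by rewrite eZ properxx in pZY.
Qed.

(** This passes from elements to subgroups: an element of [C] inside [P] centralises the chief
    factor because [P] does, and one outside [P] falls under [no_quad]. *)
Lemma no_quad_cent C X Y :
    C \subset S -> Y \subset P -> chief_factor G X Y ->
  [~: Y, C, C] \subset X -> [~: Y, C] \subset X.
Proof.
move=> sCS sYP chf qC; have [pXY /andP[sYG _] nXG _] := chief_factorP _ _ chf.
have nXY := subset_trans sYG nXG.
have nXC := subset_trans (subset_trans sCS sSG) nXG.
rewrite -quotient_cents2 // centsC; apply/subsetP=> _ /morphimP[c nXc Cc ->].
have eqc : [~: Y / X, [set coset X c]] = [~: Y, [set c]] / X.
  by rewrite -quotient_set1 // -quotientR ?sub1set.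
have [Pc | P'c] := boolP (c \in P).
  have := chief_factor_cent pP nsPG sYP chf.
  rewrite -quotient_cents2 ?(subset_trans (normal_sub nsPG)) // centsC.
  by move/subsetP; apply; apply: mem_quotient.
have Sc : c \in S :\: P by rewrite inE P'c (subsetP sCS).
have nRc : [~: Y, [set c]] \subset 'N(X).
  apply: subset_trans nXG; rewrite comm_subG // sub1set.
  by rewrite (subsetP (subset_trans sCS sSG)).
have := no_quad Sc sYP chf; rewrite /acts_quadratically_on /acts_nontrivially_on.
rewrite eqc -quotient_set1 // -quotientR ?sub1set // negbK.
have -> : [~: Y, [set c], [set c]] / X == 1.
  rewrite -subG1 quotient_sub1; last first.
    by rewrite comm_subG ?sub1set.
  by rewrite (subset_trans _ qC) // !commgSS ?sub1set.
move/(_ isT); rewrite -[_ / X]/(([~: Y, [set c]])%G / X) => /eqP Y1.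
move/eqP: eqc; rewrite Y1 => /eqP/commG1P.
by rewrite centsC sub1set.
Qed.

(** ['Z(Y)] is [G]-invariant between [X] and [Y], so it is one of the two. If it is [X], condition
    (iii) is [no_quad_cent]; if it is [Y], the condition is immediate. *)
Lemma chief_factor_K1 X Y :
    Y \subset P -> chief_factor G X Y -> X \subset 'Z(Y) ->
    [~: Y, Y] \subset 'Z(Y) ->
  Y \in Kseq S 1.
Proof.
move=> sYP chf sXZ cl2; have [pXY /andP[sYG nYG] nXG maxX] := chief_factorP _ _ chf.
apply/KopP; split=> // [|B|B].
- exact: subset_trans sYP sPS.
- by rewrite inE => sBS; apply: subset_trans nYG; apply: subset_trans sSG.
case/exists_inP=> C; rewrite inE => sCS sBC.
have sBS := subset_trans sBC sCS.
have nZG : G \subset 'N('Z(Y)) by rewrite gFnorm_trans.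
have [->|->] := maxX 'Z(Y)%G sXZ (center_sub _) nZG.
  exact: no_quad_cent.
by rewrite commg_subl => _; apply: subset_trans nYG; apply: subset_trans sSG.
Qed.

Lemma K2_cent N0 X Y B :
    Y \subset P -> chief_factor G X Y -> X \subset 'Z(Y) ->
    [~: Y, Y] \subset X -> N0 \subset 'C(X) -> 
    N0 <*> B <|<| G -> B \in Kseq S 2 ->
  [~: Y, B] \subset X.
Proof.
move=> sYP chf sXZ cl2 cN0X snM K2B.
have [pXY /andP[sYG nYG] nXG maxX] := chief_factorP _ _ chf.
have K1Y : Y \in Kseq S 1 := chief_factor_K1 sYP chf sXZ (subset_trans cl2 sXZ).
have [sBS cl2B nB cB] := KopP _ _ _ K2B.
have nBY := nB Y K1Y; have sBG := subset_trans sBS sSG.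
have nYB := subset_trans sBG nYG; have sMG := subnormal_sub snM.
have sN0G := subset_trans (joing_subl N0 B) sMG.
have sXY := proper_sub pXY; have nXY := subset_trans sYG nXG.
have nXM := subset_trans sMG nXG.
have cXY : X \subset 'C(Y) by rewrite (subset_trans sXZ) ?subsetIr.
(* This is a subgroup because commutators of [Y] lie in [X], which is central in [Y]. *)
pose R0 := [set y in Y | [set [~ y, z] | z in Y] \subset 'C(B)].
have memX y z : y \in Y -> z \in Y -> [~ y, z] \in X.
  by move=> Yy Yz; apply: (subsetP cl2); apply: mem_commg.
have gR : group_set R0.
  apply/group_setP; split.
    rewrite inE group1; apply/subsetP=> _ /imsetP[b Bb ->].
    by rewrite comm1g group1.
  move=> v w; rewrite !inE => /andP[Yv cv] /andP[Yw cw].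
  rewrite groupM //; apply/subsetP=> _ /imsetP[z Yz ->].
  rewrite commMgJ [_ ^ w]conjgE (centsP cXY _ (memX v z Yv Yz) w Yw) mulKg.
  apply: groupM; first exact: (subsetP cv) _ (imset_f _ _).
  exact: (subsetP cw) _ (imset_f _ _).
pose R := Group gR.
have sRY : R \subset Y by apply/subsetP=> y; rewrite inE => /andP[].
have cRY : [~: R, Y] \subset 'C(B).
  rewrite gen_subG; apply/subsetP=> _ /imset2P[y z + Yz ->].
  by rewrite inE => /andP[_ /subsetP]; apply; apply: imset_f.
have nRM : N0 <*> B \subset 'N(R).
  apply/subsetP=> m Mm; rewrite inE; apply/subsetP=> _ /imsetP[y Ry ->].
  have nYm : m \in 'N(Y) by rewrite (subsetP nYG) ?(subsetP sMG).
  have Yy := subsetP sRY y Ry.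
  rewrite inE memJ_norm // Yy; apply/subsetP=> _ /imsetP[z Yz ->].
  have Yzm : z ^ m^-1 \in Y by rewrite memJ_norm ?groupV.
  rewrite -[z](conjgKV m) -conjRg.
  have : [~ y, z ^ m^-1] \in 'C(B) :&: X.
    by rewrite inE memX // (subsetP cRY) ?mem_commg.
  (* [N0] centralises this intersection, being trivial on [X], while [B] normalises both of its
     terms. *)
  have : N0 <*> B \subset 'N('C(B) :&: X).
    rewrite join_subG; apply/andP; split.
      by rewrite cents_norm // (subset_trans cN0X) ?centS ?subsetIr.
    rewrite normsI ?(subset_trans sBG nXG) //.
    by rewrite (subset_trans (normG B)) ?cent_norm.
  move/subsetP/(_ m Mm) => nm cX.
  have : [~ y, z ^ m^-1] ^ m \in 'C(B) :&: X by rewrite memJ_norm.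
  by case/setIP.
have nZBY : Y \subset 'N('Z(B)) by rewrite gFnorm_trans.
have YB_B : [~: Y, B] \subset B by rewrite commg_subr.
have YB_Y : [~: Y, B] \subset Y by rewrite commg_subl.
(* As [Y] normalises [B], [Y, B, B] <= [B, B] <= Z(B), and commutators of Z(B) with [Y] stay in
   Z(B). *)
have qVR : [~: Y, B, B] \subset R.
  apply/subsetP=> y YBBy.
  have Yy : y \in Y.
    by apply: (subsetP _ y YBBy); rewrite (subset_trans (commSg _ YB_Y)).
  have ZBy : y \in 'Z(B).
    by apply: (subsetP cl2B); apply: (subsetP _ y YBBy); rewrite commSg.
  rewrite inE Yy; apply/subsetP=> _ /imsetP[z Yz ->].
  have : [~ y, z] \in 'Z(B).
    by apply: (subsetP _ _ (mem_commg ZBy Yz)); rewrite commg_subl.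
  by case/setIP.
have qR : [~: R, B, B] = 1.
  (* Condition (iii) for [B] is tested on [R], a subgroup of the member [Y] of K_1(S): [B, R, R]
     lies in [B] and in [Y, R], which centralises [B]. *)
  have ZBR : [~: B, R] \subset 'Z(B).
    apply: cB; first by apply/exists_inP; exists Y.
    have BR_Y : [~: B, R] \subset Y.
      by rewrite commGC (subset_trans (commSg _ sRY)).
    rewrite subsetI; apply/andP; split.
      rewrite (subset_trans (commSg _ (_ : _ \subset B))) ?commg_subl //.
        exact: subset_trans nBY.
      exact: subset_trans nBY.
    by rewrite (subset_trans (commgSS BR_Y (subxx R))) // commGC.
  by apply/commG1P; rewrite commGC (subset_trans ZBR) ?subsetIr.
(* It remains to show that [B] is quadratic on [Y / X]; this is obtained in [G / X] from the
   quadratic actions on [R / X] and modulo it. *)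
apply: no_quad_cent => //.
have sBM : B \subset N0 <*> B := joing_subr _ _.
have nXB := subset_trans sBM nXM; have nXR := subset_trans sRY nXY.
have qC (A : {group gT}) : A \subset 'N(X) ->
    [~: A, B] \subset 'N(X) /\ [~: A, B, B] / X = [~: A / X, B / X, B / X].
  move=> nXA; have nXAB : [~: A, B] \subset 'N(X) by rewrite comm_subG.
  by split; rewrite // quotientR // quotientR.
have [nXYB qCY] := qC Y nXY; have [_ qCR] := qC R nXR.
rewrite -quotient_sub1 ?comm_subG // qCY subG1; apply/eqP.
apply: (@quadratic_subnormal _ (G / X)%G (N0 <*> B / X)%G (B / X)%G (R / X)%G).
- exact: quotient_subnormal.
- exact: chief_factor_minnormal.
- by rewrite /= /abelian quotient_cents2.
- exact: quotientS.
- exact: quotient_norms.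
- by rewrite /= -qCY quotientS.
by rewrite /= -qCR qR quotient1.
Qed.

Lemma K2_sub_pcore B : B \in Kseq S 2 -> B \subset P.
Proof.
move=> K2B; have sBG := subset_trans (Kseq_subgroups K2B) sSG.
pose N := <<class_support B G>>%G; pose N0 := pprime_gen p N.
have nNG : G \subset 'N(N) by rewrite norms_gen // class_support_norm.
have sNG : N \subset G by rewrite gen_subG class_support_subG.
have sBN : B \subset N by rewrite sub_gen // sub_class_support.
have sN0N : N0 \subset N := pprime_gen_sub p N.
have sN0G := subset_trans sN0N sNG.
have nN0G : G \subset 'N(N0) by apply: pprime_gen_norm.
(* If [N0] centralises [P], characteristic p forces [N0] into [P]; then [N] is a normal p-subgroup
   of [G], so it lies in [P]. *)
have [cPN0 | ncPN0] := eqVneq [~: P, N0] 1.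
  apply: subset_trans sBN _; apply: pcore_max; last exact/andP.
  apply: pprime_gen_pgroup p_pr; apply: pgroupS pP.
  apply: subset_trans charG; rewrite subsetI sN0G centsC.
  exact/commG1P.
pose bad (Y : {group gT}) := ([~: Y, N0] != 1) && (G \subset 'N(Y)).
have [|Y minY sYP] := @mingroup_exists _ bad 'O_p(G)%G.
  by rewrite /bad ncPN0 normal_norm.
have [/andP[ntYN nYG] minYP] := mingroupP minY.
have sYG := subset_trans sYP (normal_sub nsPG).
have pY := pgroupS sYP pP.
have nYN0 := subset_trans sN0G nYG.
(* By coprime action [N0] does not centralise [Y, N0] either, so minimality of [Y] applies to this
   [G]-invariant subgroup. *)
have eqYN : [~: Y, N0] = Y.
  apply: (minYP [~: Y, N0]%G); last by rewrite commg_subl.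
  rewrite /bad normsR // andbT; apply: contraNneq ntYN => YNN.
  by rewrite (pprime_gen_cent pY (subset_trans sNG nYG)).
have ntY : Y :!=: 1 by apply: contraNneq ntYN => ->; rewrite comm1G.
pose max1 (Z : {group gT}) := (Z \proper Y) && (G \subset 'N(Z)).
have [|X maxX _] := @maxgroup_exists _ max1 1%G.
  by rewrite /max1 proper1G ntY norms1.
have chf : chief_factor G X Y by apply/andP; split; [exact: maxX | apply/andP].
have [pXY _ nXG _] := chief_factorP _ _ chf.
have cXN0 : [~: X, N0] = 1.
  apply/eqP; apply: contraT => ntXN.
  have eqXY : X :=: Y by apply: minYP (proper_sub pXY); rewrite /bad ntXN.
  by rewrite eqXY properxx in pXY.
have sXY := proper_sub pXY.
have cXY : [~: X, Y] = 1.
  rewrite -eqYN commGC; apply: three_subgroup.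
    by rewrite [[~: N0, X]]commGC cXN0 comm1G.
  by apply/trivgP; rewrite -cXN0 commSg // commg_subl (subset_trans sYG).
have sXZ : X \subset 'Z(Y) by rewrite subsetI sXY; apply/commG1P.
have cl2 : [~: Y, Y] \subset X.
  rewrite (subset_trans _ (chief_factor_cent pP nsPG sYP chf)) //.
  exact: commgS.
have YBX : [~: Y, B] \subset X.
  have cN0X : N0 \subset 'C(X) by rewrite centsC; apply/commG1P.
  apply: (K2_cent sYP chf sXZ cl2 cN0X _ K2B).
  apply: subnormal_trans (normal_subnormal (_ : N <| G)); last exact/andP.
  apply: (@subnormal_pquotient _ p _ _ N0); rewrite ?joing_subl //.
  - by rewrite /normal sN0N (subset_trans sNG).
  - exact: pprime_gen_quotient.
  by rewrite join_subG sN0N.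
(* [G] normalises [X] and [Y], so every conjugate of [B] centralises [Y / X] along with [B], and
   these conjugates generate [N]. *)
have YNX : [~: Y, N] \subset X.
  have nXY := subset_trans sYG nXG; have nXN := subset_trans sNG nXG.
  rewrite -quotient_cents2 // centsC quotient_gen; last first.
    exact: subset_trans (subset_gen _) nXN.
  rewrite gen_subG; apply/subsetP=> _ /morphimP[x _ + ->].
  rewrite class_supportEr => /bigcupP[g Gg Bgx].
  have nXg := subsetP nXG g Gg.
  have nXBg : B :^ g \subset 'N(X).
    by rewrite -(normP nXg) normJ conjSg (subset_trans sBG).
  apply: (subsetP (_ : B :^ g / X \subset _)); last exact: mem_quotient.
  rewrite centsC quotient_cents2 // -(normsP nYG g Gg) -conjsRg.
  by rewrite -(normP nXg) conjSg.
case/negP: (proper_subn pXY).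
by rewrite -{1}eqYN (subset_trans _ YNX) ?commgS.
Qed.

End Main.

Theorem theoremC (gT : finGroupType) (p : nat) (G S : {group gT})
    (p_pr : prime p) (p_ge3 : (3 <= p)%N)
    (charG : of_characteristic p G)
    (sSG : S \subset G) (pS : p.-group S) (sOS : 'O_p(G) \subset S) :
  Kinfty S <| G \/
  exists (g : gT) (X Y : {group gT}),
    [/\ g \in S :\: 'O_p(G),
        X \subset 'O_p(G),
        chief_factor G Y X,
        acts_nontrivially_on g X Y &
        acts_quadratically_on g X Y].
Proof.
have [exq | no_quad] := boolp.EM (exists (g : gT) (X Y : {group gT}),
    [/\ g \in S :\: 'O_p(G), X \subset 'O_p(G), chief_factor G Y X,
        acts_nontrivially_on g X Y & acts_quadratically_on g X Y]).
  by right.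
left; rewrite (@Kinfty_restrict _ S 'O_p(G)%G) //.
  rewrite /normal (subset_trans _ (norm_Kinfty _)) ?gFnorm // andbT.
  rewrite gen_subG; apply/bigcupsP=> A /Kinfty_membersP/(_ 0%N isT).
  by move/Kseq_subgroups=> sAP; apply: subset_trans sAP (pcore_sub _ _).
move=> B; apply: K2_sub_pcore => // g X Y Sg sXP chf qg.
by apply/negP=> ng; apply: no_quad; exists g, X, Y.
Qed.
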